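(* Let $p(z)$ be a polynomial with complex coefficients of degree $n\ge 2$ and let $F(z)=|p(z)|^2$. Let $z_0\in\mathbb{C}$ with $p(z_0)\neq 0$, and let $z_1=\widehat N_p(z_0)$ be the Robust Newton iterate at $z_0$. With $k=k(z_0)$, $A(z_0)$, $u_k(z_0)$ and $C_k$ the associated quantities at $z_0$, we have $$F(z_1)-F(z_0)\;\le\; -9A^2(z_0)\left(\frac{C_k}{3}\right)^{k+1}\;\le\; -\frac12\,\frac{|u_k(z_0)|^{k+1}}{18^k\,A^{2k}(z_0)}.$$
   Context: For a complex polynomial $p$ of degree $n\ge 2$ and $z\in\mathbb{C}$ with $p(z)\ne 0$, define $k=k(z)=\min\{j\ge 1: p^{(j)}(z)\ne 0\}$, $A(z)=\max\{|p^{(j)}(z)|/j! : j=0,\dots,n\}$, $u_k=u_k(z)=\frac{1}{k!}p(z)\overline{p^{(k)}(z)}$, $\gamma=2\,\mathrm{Re}(u_k^{k-1})$, $\delta=-2\,\mathrm{Im}(u_k^{k-1})$, $c_k=\max\{|\gamma|,|\delta|\}$ (with $u_k^{0}=1$). Let $\theta$ be any angle satisfying: $\theta=0$ if $c_k=|\gamma|$ and $\gamma<0$; $\theta=\pi/k$ if $c_k=|\gamma|$ and $\gamma>0$; $\theta=\pi/(2k)$ if $c_k=|\delta|$ and $\delta<0$; $\theta=3\pi/(2k)$ if $c_k=|\delta|$ and $\delta>0$ (if two cases apply, either value may be chosen). The Robust Newton iterate at $z$ is $$\widehat N_p(z)=z+\frac{C_k}{3}\frac{u_k}{|u_k|}e^{i\theta},\qquad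 C_k=\frac{c_k|u_k|^{2-k}}{6A^2(z)}.$$ *)

(* Defs.v *)
(* MathComp-Analysis: for every [R : realType], [R[i]] is the field of complex
   numbers over [R]. *)
From HB Require Import structures.
From mathcomp Require Import all_boot all_order all_algebra.
From mathcomp Require Import all_classical all_reals all_analysis.
From mathcomp Require Import complex.

Set Implicit Arguments.
Unset Strict Implicit.
Unset Printing Implicit Defensive.

Import Order.TTheory GRing.Theory Num.Theory.
Import Normc.

Local Open Scope ring_scope.
Local Open Scope complex_scope.

Section RobustNewton.
Context {R : realType}.
Implicit Types (p : {poly R[i]}) (z u : R[i]) (t : R).

(* [normc] is the R-valued modulus; the norm [`|z|] of [R[i]] is R[i]-valued. *)
Definition sqmod p z : R := normc p.[z] ^+ 2.

Definition cis t : R[i] := cos t +i* sin t.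

(* min {j >= 1 : p^(j)(z) <> 0}; the value 0 is only taken when this set is
   empty, i.e. when p is constant. *)
Definition rn_k p z : nat :=
  if pselect (exists j, (0 < j)%N && (p^`(j).[z] != 0)) is left h
  then ex_minn h else 0%N.

(* [size p] is deg p + 1, so j ranges over 0, ..., deg p. *)
Definition rn_A p z : R :=
  \big[Num.max/0]_(0 <= j < size p) (normc p^`(j).[z] / j`!%:R).

Definition rn_u p z : R[i] :=
  (rn_k p z)`!%:R^-1 * p.[z] * conjc p^`(rn_k p z).[z].

Definition rn_gamma p z : R := 2 * complex.Re (rn_u p z ^+ (rn_k p z).-1).

Definition rn_delta p z : R := - 2 * complex.Im (rn_u p z ^+ (rn_k p z).-1).

Definition rn_c p z : R := Num.max `|rn_gamma p z| `|rn_delta p z|.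

(* A disjunction rather than a conjunction of implications: when two cases
   apply, either of the two angles is admissible. *)
Definition rn_angle p z t : Prop :=
  let k := rn_k p z in
  [\/ [/\ rn_c p z = `|rn_gamma p z|, rn_gamma p z < 0 & t = 0],
      [/\ rn_c p z = `|rn_gamma p z|, 0 < rn_gamma p z & t = pi / k%:R],
      [/\ rn_c p z = `|rn_delta p z|, rn_delta p z < 0 & t = pi / (2 * k%:R)]
    | [/\ rn_c p z = `|rn_delta p z|, 0 < rn_delta p z
        & t = 3 * pi / (2 * k%:R)]].

(* The exponent 2 - k is an integer, negative as soon as k > 2. *)
Definition rn_C p z : R :=
  rn_c p z * normc (rn_u p z) ^ (2 - (rn_k p z)%:Z) / (6 * rn_A p z ^+ 2).

Definition robust_newton p z t : R[i] :=
  z + (rn_C p z / 3)%:C * (rn_u p z / (normc (rn_u p z))%:C) * cis t.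

End RobustNewton.

(* Main.v *)
(* Write p(z0 + w) = a_0 + a_k w^k + E, where a_j are the Taylor coefficients at
   z0, and let r = |w| = C/3.  The angle theta is chosen so that
   2 Re(conj(a_0) a_k w^k) = - c_k |u|^(2-k) r^k = - 18 A^2 r^(k+1).  As
   |a_j| <= A and r <= 1/9, one has |E| <= (9/8) A r^(k+1), so the remaining
   terms of |p(z0 + w)|^2 - |a_0|^2 are at most
   (9/4 + 81/64) A^2 r^(k+1) <= 9 A^2 r^(k+1).  The second inequality only uses
   r >= |u| / (18 A^2), which follows from c_k >= |u|^(k-1). *)
Require Import Defs.
From HB Require Import structures.
From mathcomp Require Import all_boot all_order all_algebra.
From mathcomp Require Import all_classical all_reals all_analysis.
From mathcomp Require Import complex.
From mathcomp Require Import ring lra zify.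

Import Order.TTheory GRing.Theory Num.Theory.
Import Normc.

Local Open Scope ring_scope.
Local Open Scope complex_scope.

(** * Moduli, real parts and points of the unit circle *)

Lemma normc_ge0 (R : rcfType) (x : R[i]) : 0 <= normc x.
Proof. by case: x => a b; exact: sqrtr_ge0. Qed.

Lemma sqr_normcE (R : rcfType) (x : R[i]) :
  normc x ^+ 2 = complex.Re x ^+ 2 + complex.Im x ^+ 2.
Proof. by case: x => a b; rewrite sqr_sqrtr // addr_ge0 ?sqr_ge0. Qed.

Lemma normcX (R : rcfType) (x : R[i]) m : normc (x ^+ m) = normc x ^+ m.
Proof. by elim: m => [|m IH]; rewrite ?normc1 // !exprS normcM IH. Qed.

Lemma normc_conj (R : rcfType) (x : R[i]) : normc x^* = normc x.
Proof. by case: x => a b; rewrite /normc /= sqrrN. Qed.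

Lemma normc_real (R : rcfType) (x : R) : 0 <= x -> normc x%:C = x.
Proof. by move=> x0; rewrite /normc /= expr0n addr0 sqrtr_sqr ger0_norm. Qed.

Lemma normc_gt0 (R : rcfType) (x : R[i]) : x != 0 -> 0 < normc x.
Proof.
by move=> x0; rewrite lt_neqAle normc_ge0 andbT eq_sym;
  apply: contra x0 => /eqP/eq0_normc ->.
Qed.

Lemma Re_le_normc (R : rcfType) (x : R[i]) : complex.Re x <= normc x.
Proof.
apply: (le_trans (ler_norm _)).
by rewrite -ler_sqr ?nnegrE ?normc_ge0 // sqr_normcE real_normK ?num_real //
   lerDl sqr_ge0.
Qed.

Lemma sqr_normcD (R : rcfType) (x y : R[i]) :
  normc (x + y) ^+ 2 =
  normc x ^+ 2 + 2 * complex.Re (x^* * y) + normc y ^+ 2.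
Proof. by rewrite !sqr_normcE; case: x y => [a b] [c d] /=; ring. Qed.

Lemma mul_conjc (R : rcfType) (x : R[i]) : x^* * x = (normc x ^+ 2)%:C.
Proof.
rewrite sqr_normcE; case: x => a b; apply/eqP; rewrite eq_complex /=.
by apply/andP; split; apply/eqP; ring.
Qed.

Lemma le_normc_sum (R : rcfType) m (F : 'I_m -> R[i]) :
  normc (\sum_(i < m) F i) <= \sum_(i < m) normc (F i).
Proof.
elim/big_rec2: _ => [|i y1 y2 _ IH]; first by rewrite normc0.
by apply: (le_trans (le_normcD _ _)); rewrite lerD2l.
Qed.

Lemma cisX (R : realType) (t : R) m : cis t ^+ m = cis (m%:R * t).
Proof.
elim: m => [|m IH]; first by rewrite expr0 mul0r /cis cos0 sin0.
rewrite exprS IH -natr1 mulrDl mul1r [_ + t]addrC /cis cosD sinD.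
apply/eqP; rewrite eq_complex /=; apply/andP; split; apply/eqP => //.
by rewrite [RHS]addrC; congr (_ + _); rewrite mulrC.
Qed.

Lemma normc_cis (R : realType) (t : R) : normc (cis t) = 1.
Proof. by rewrite /normc /= cos2Dsin2 sqrtr1. Qed.

(** * Taylor expansion with a small increment *)

Lemma geometric_sum_le (R : realFieldType) (r : R) m :
  0 <= r -> r <= 1 / 9 -> \sum_(i < m) r ^+ i <= 9 / 8.
Proof.
move=> r0 r9; elim: m => [|m IH]; first by rewrite big_ord0; lra.
rewrite big_ord_recl expr0.
under eq_bigr => i _ do rewrite /= exprS.
rewrite -mulr_sumr.
have S0 : 0 <= \sum_(i < m) r ^+ i by apply: sumr_ge0 => i _; exact: exprn_ge0.
set S := \sum_(i < m) _ in IH S0 *.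
(* The bound 9/8 = 1 / (1 - 1/9) is the full series at r = 1/9, and it is stable: 1 + r S <= 1 +
   (1/9)(9/8) = 9/8. *)
nra.
Qed.

Lemma taylor_leading_terms (R : rcfType) (p : {poly R[i]}) (z w : R[i]) (A : R) k :
  (0 < k)%N -> (forall j, (0 < j < k)%N -> p^`N(j).[z] = 0) ->
  (forall j, normc p^`N(j).[z] <= A) -> normc w <= 1 / 9 ->
  exists2 E, p.[z + w] = p.[z] + (p^`N(k).[z] * w ^+ k + E) &
    normc E <= 9 / 8 * A * normc w ^+ k.+1.
Proof.
move=> k0 pj0 pjA w9.
have A0 : 0 <= A := le_trans (normc_ge0 _ _) (pjA 0%N).
(* The tail of the expansion with w^(k+1) factored out. Summing over all [i < size p] runs past the
   degree, where the coefficients vanish, and avoids a truncated subtraction. *)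
exists ((\sum_(i < size p) p^`N(k.+1 + i).[z] * w ^+ i) * w ^+ k.+1).
  rewrite (@nderiv_taylor_wide _ (k.+1 + size p)) ?leq_addl //; last exact: mulrC.
  rewrite big_split_ord big_ord_recr /= -addrA; congr (_ + (_ + _)).
    (* Of the terms of index below k only the constant one survives. *)
    case: k k0 pj0 => // k _ pj0; rewrite big_ord_recl /= nderivn0 expr0 mulr1.
    rewrite big1 ?addr0 // => i _.
    by rewrite pj0 ?mul0r //= /bump add1n ltnS ltn_ord.
  by rewrite mulr_suml; apply: eq_bigr => i _; rewrite -mulrA -exprD [(i + _)%N]addnC.
rewrite normcM normcX ler_wpM2r ?exprn_ge0 ?normc_ge0 //.
apply: (le_trans (le_normc_sum _ _ _)).
apply: (@le_trans _ _ (\sum_(i < size p) A * normc w ^+ i)).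
  by apply: ler_sum => i _; rewrite normcM normcX ler_wpM2r ?exprn_ge0 ?normc_ge0.
rewrite -mulr_sumr mulrC ler_wpM2r //.
by apply: geometric_sum_le => //; exact: normc_ge0.
Qed.

(** * The quantities k, A, u, c and the angle *)

Lemma derivn_nderivn (R : rcfType) (p : {poly R[i]}) (z : R[i]) j :
  p^`(j).[z] = j`!%:R * p^`N(j).[z].
Proof. by rewrite nderivn_def hornerMn mulr_natl. Qed.

Lemma fact_neq0 (R : numDomainType) j : j`!%:R != 0 :> R.
Proof. by rewrite pnatr_eq0 -lt0n fact_gt0. Qed.

Lemma rn_kP (R : realType) (p : {poly R[i]}) z : (1 < size p)%N ->
  [/\ (0 < rn_k p z)%N, p^`N(rn_k p z).[z] != 0 &
    forall j, (0 < j < rn_k p z)%N -> p^`N(j).[z] = 0].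
Proof.
move=> p1.
have h : exists j, (0 < j)%N && (p^`(j).[z] != 0).
  exists (size p).-1; rewrite -ltnS prednK ?p1 ?(ltnW p1) //=.
  (* The derivative of order deg p is a nonzero constant, so the set defining k is inhabited and the
     default 0 does not occur. *)
  have -> : p^`((size p).-1) = (lead_coef p)%:P *+ (size p).-1`!.
    rewrite nderivn_def; congr (_ *+ _); apply/polyP => i.
    rewrite coef_nderivn coefC; case: i => [|i]; first by rewrite addn0 binn.
    rewrite nth_default ?mul0rn // addnS -addSn prednK ?(ltnW p1) //.
    exact: leq_addr.
  rewrite hornerMn hornerC -mulr_natr mulf_neq0 ?fact_neq0 ?lead_coef_eq0 //.
  by rewrite -size_poly_gt0 ltnW.
rewrite /rn_k; case: pselect => // h'.
case: ex_minnP => k /andP[k0 pk] kmin; split=> //.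
  by apply: contra pk => /eqP e; rewrite derivn_nderivn e mulr0.
move=> j /andP[j0 jk]; apply/eqP/negPn/negP => pj.
have := kmin j; rewrite j0 derivn_nderivn mulf_neq0 ?fact_neq0 // leqNgt jk.
by move=> /(_ isT).
Qed.

Lemma normc_nderivn_le (R : realType) (p : {poly R[i]}) z j :
  normc p^`N(j).[z] <= rn_A p z.
Proof.
have A0 : 0 <= rn_A p z by rewrite /rn_A; exact: bigmax_ge_id.
have [pj|jp] := leqP (size p) j; first by rewrite nderivn_poly0 // horner0 normc0.
have -> : normc p^`N(j).[z] = normc p^`(j).[z] / j`!%:R.
  by rewrite nderivn_def hornerMn normcMn -[_ *+ j`!]mulr_natr mulfK ?fact_neq0.
rewrite /rn_A.
by apply: (@le_bigmax_seq _ _ _ _ _ j xpredT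
  (fun j => normc p^`(j).[z] / j`!%:R)); rewrite // mem_index_iota.
Qed.

(** The factor 1/k! turns the derivative into the Taylor coefficient a_k, so that u = a_0
    conj(a_k). *)
Lemma rn_uE (R : realType) (p : {poly R[i]}) z :
  rn_u p z = p.[z] * p^`N(rn_k p z).[z]^*.
Proof.
rewrite /rn_u derivn_nderivn rmorphM /= conjc_nat.
by rewrite mulrCA !mulrA divff ?fact_neq0 // mul1r.
Qed.

(** With v = u^(k-1), c is twice the larger of |Re v| and |Im v|, and that larger part lies between
    |v|/2 and |v|. *)
Lemma rn_c_bounds (R : realType) (p : {poly R[i]}) z :
  normc (rn_u p z) ^+ (rn_k p z).-1 <= rn_c p z
    <= 2 * normc (rn_u p z) ^+ (rn_k p z).-1.
Proof.
rewrite /rn_c /rn_gamma /rn_delta -normcX; set v := _ ^+ _.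
have v0 := normc_ge0 _ v; have v2 := sqr_normcE _ v.
move: v0 v2; move: (normc v) (complex.Re v) (complex.Im v) => V x y V0 V2.
rewrite !normrM normrN normr_nat.
have x0 := normr_ge0 x; have y0 := normr_ge0 y.
move: V2; rewrite -(real_normK (num_real x)) -(real_normK (num_real y)).
move: `|x| `|y| x0 y0 => a b a0 b0 V2.
rewrite le_max ge_max; apply/andP; split; last by apply/andP; split; nra.
have [ab|/ltW ab] := leP a b; apply/orP; [right|left]; nra.
Qed.

(** In the four cases k theta is 0, pi, pi/2 or 3pi/2, so cis(theta)^k is 1, -1, i or -i: the power
    that turns the dominant part of u^(k-1) into a negative real part. *)
Lemma Re_rn_angle (R : realType) (p : {poly R[i]}) z t : (0 < rn_k p z)%N ->
  rn_angle p z t ->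
  2 * complex.Re (rn_u p z ^+ (rn_k p z).-1 * cis t ^+ rn_k p z) = - rn_c p z.
Proof.
move=> k0; rewrite cisX /rn_angle /rn_gamma /rn_delta.
move: (rn_u p z ^+ _) => [x y].
have kn0 : (rn_k p z)%:R != 0 :> R by rewrite pnatr_eq0 -lt0n.
case=> -[-> s ->].
- by rewrite mulr0 /cis cos0 sin0 ltr0_norm //=; ring.
- have -> : (rn_k p z)%:R * (pi / (rn_k p z)%:R) = pi :> R by field.
  by rewrite /cis cospi sinpi gtr0_norm //=; ring.
- have -> : (rn_k p z)%:R * (pi / (2 * (rn_k p z)%:R)) = pi / 2 :> R by field.
  by rewrite /cis cos_pihalf sin_pihalf ltr0_norm //=; ring.
- have -> : (rn_k p z)%:R * (3 * pi / (2 * (rn_k p z)%:R)) = pi + pi / 2 :> R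
    by field.
  by rewrite /cis cosDpihalf sinDpihalf cospi sinpi gtr0_norm //=; ring.
Qed.

(** * Size of the step, and the resulting decrease *)

Lemma step_size_bounds (R : realFieldType) (a U x r : R) :
  0 < U -> U <= a -> U <= x <= 2 * U -> 18 * a * r = x -> 0 < r <= 1 / 9.
Proof.
move=> U0 Ua /andP[Ux xU] rx.
have a0 : 0 < 18 * a by lra.
by apply/andP; split; [rewrite -(pmulr_rgt0 _ a0) | rewrite -(ler_pM2l a0)];
  rewrite rx; lra.
Qed.

Lemma descent_value_le (R : realFieldType) (A U r : R) k :
  0 < A -> 0 < U -> U <= 18 * A ^+ 2 * r ->
  - 9 * A ^+ 2 * r ^+ k.+1
    <= - (1 / 2) * (U ^+ k.+1 / (18 ^+ k * A ^+ (2 * k))).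
Proof.
move=> A0 U0 Ur.
have a0 : 0 < A ^+ 2 by rewrite exprn_gt0.
have a18 : 0 < 18 * A ^+ 2 by lra.
have V0 : 0 < U / (18 * A ^+ 2) by rewrite divr_gt0.
have rV : U / (18 * A ^+ 2) <= r by rewrite ler_pdivrMr // mulrC.
have rVk : (U / (18 * A ^+ 2)) ^+ k.+1 <= r ^+ k.+1.
  by rewrite lerXn2r // nnegrE ltW // (lt_le_trans V0).
(* The right-hand bound is the middle one evaluated at the smallest admissible r, as 9/18 = 1/2;
   what remains is monotonicity of the power. *)
have -> : - (1 / 2) * (U ^+ k.+1 / (18 ^+ k * A ^+ (2 * k)))
   = - 9 * A ^+ 2 * (U / (18 * A ^+ 2)) ^+ k.+1.
  rewrite exprMn exprVn exprMn [18 ^+ k.+1]exprS [(A ^+ 2) ^+ k.+1]exprS exprM.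
  by field; rewrite !expf_neq0 ?pnatr_eq0 //= ?gt_eqF.
by rewrite !mulNr lerN2 ler_pM2l // mulr_gt0.
Qed.

Lemma sqmod_descent (R : realType) (p : {poly R[i]}) (z w : R[i]) (A r : R) k :
  (0 < k)%N -> (forall j, (0 < j < k)%N -> p^`N(j).[z] = 0) ->
  (forall j, normc p^`N(j).[z] <= A) -> normc w = r -> r <= 1 / 9 ->
  2 * complex.Re (p.[z]^* * (p^`N(k).[z] * w ^+ k)) = - 18 * A ^+ 2 * r ^+ k.+1 ->
  sqmod p (z + w) - sqmod p z <= - 9 * A ^+ 2 * r ^+ k.+1.
Proof.
move=> k0 aj0 aA wr r9.
have r0 : 0 <= r by rewrite -wr normc_ge0.
have a0A : normc p.[z] <= A by have := aA 0%N; rewrite nderivn0.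
have A0 : 0 <= A := le_trans (normc_ge0 _ _) a0A.
have w9 : normc w <= 1 / 9 by rewrite wr.
have [E pE EA] := taylor_leading_terms _ p z w A k k0 aj0 aA w9.
rewrite wr in EA.
have bA : normc (p^`N(k).[z] * w ^+ k) <= A * r ^+ k.
  by rewrite normcM normcX wr ler_wpM2r // exprn_ge0.
move: pE bA; set b := p^`N(k).[z] * w ^+ k => pE bA main.
have rest : 2 * complex.Re (p.[z]^* * E) <= 9 / 4 * A ^+ 2 * r ^+ k.+1.
  have ReE := Re_le_normc _ (p.[z]^* * E); rewrite normcM normc_conj in ReE.
  have aE := ler_pM (normc_ge0 _ _) (normc_ge0 _ _) a0A EA.
  have -> : 9 / 4 * A ^+ 2 * r ^+ k.+1 = 2 * (A * (9 / 8 * A * r ^+ k.+1)) by field.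
  by rewrite ler_pM2l // (le_trans ReE).
(* Since r <= 1/9, the remainder is at most A r^k / 8, whence 1 + 1/8 = 9/8. *)
have bE : normc (b + E) <= 9 / 8 * A * r ^+ k.
  apply: (le_trans (le_normcD _ _)).
  have Ark : 0 <= A * r ^+ k by rewrite mulr_ge0 // exprn_ge0.
  have ArkE : 9 / 8 * A * r ^+ k.+1 <= 1 / 8 * (A * r ^+ k).
    have -> : 9 / 8 * A * r ^+ k.+1 = 9 / 8 * r * (A * r ^+ k).
      by rewrite exprS; ring.
    by apply: ler_wpM2r; last lra.
  lra.
have sq : normc (b + E) ^+ 2 <= 81 / 64 * A ^+ 2 * r ^+ k.+1.
  apply: (@le_trans _ _ ((9 / 8 * A * r ^+ k) ^+ 2)).
    by rewrite ler_sqr ?nnegrE ?normc_ge0 // !mulr_ge0 // exprn_ge0.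
  rewrite exprMn -exprM exprMn.
  have -> : (9 / 8) ^+ 2 = 81 / 64 :> R by field.
  rewrite ler_wpM2l //; first by rewrite mulr_ge0 ?exprn_ge0 //; lra.
  (* As k >= 1, the exponent 2k is at least k + 1, and r <= 1. *)
  by apply: ler_wiXn2l; [|lra|lia].
rewrite /sqmod pE sqr_normcD mulrDr raddfD /= mulrDr main.
have : 0 <= A ^+ 2 * r ^+ k.+1 by rewrite mulr_ge0 // exprn_ge0.
lra.
Qed.

Lemma ReZ (R : rcfType) (x : R) (y : R[i]) :
  complex.Re (x%:C * y) = x * complex.Re y.
Proof. by case: y => a b /=; ring. Qed.

Lemma normc_robust_step (R : realType) (u : R[i]) (r t : R) :
  0 <= r -> u != 0 -> normc (r%:C * (u / (normc u)%:C) * cis t) = r.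
Proof.
move=> r0 /normc_gt0 u0.
by rewrite !normcM normcV normc_cis !normc_real ?(ltW u0) // divff ?gt_eqF // !mulr1.
Qed.

(** Here conj(u) u^k = |u|^2 u^(k-1), and dividing by |u|^k leaves q = |u|^(2-k). The equation for
    [q] keeps integer exponents out of the computation. *)
Lemma robust_step_factor (R : realType) (u : R[i]) (q r t : R) k :
  (0 < k)%N -> u != 0 -> q * normc u ^+ k = normc u ^+ 2 ->
  u^* * (r%:C * (u / (normc u)%:C) * cis t) ^+ k =
  (q * r ^+ k)%:C * (u ^+ k.-1 * cis t ^+ k).
Proof.
move=> k0 u0 qU.
have UC : (normc u)%:C != 0 :> R[i].
  by rewrite eq_complex /= eqxx andbT gt_eqF ?normc_gt0.
rewrite !exprMn exprVn -{2}(prednK k0) [u ^+ _.+1]exprS.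
rewrite rmorphM rmorphXn /=.
have -> : q%:C = (u^* * u) / (normc u)%:C ^+ k :> R[i].
  by rewrite mul_conjc -qU rmorphM rmorphXn /= mulfK // expf_neq0.
move: (_ ^-1) => i; ring.
Qed.

Theorem theorem1 (R : realType) (n : nat) (p : {poly R[i]}) (z0 : R[i])
    (theta : R) (hn : (2 <= n)%N) (hp : size p = n.+1) (hz0 : p.[z0] != 0)
    (htheta : rn_angle p z0 theta) :
  let z1 := robust_newton p z0 theta in
  let k := rn_k p z0 in
  let A := rn_A p z0 in
  let u := rn_u p z0 in
  let C := rn_C p z0 in
  sqmod p z1 - sqmod p z0 <= - 9 * A ^+ 2 * (C / 3) ^+ k.+1 /\
  - 9 * A ^+ 2 * (C / 3) ^+ k.+1
    <= - (1 / 2) * (normc u ^+ k.+1 / (18 ^+ k * A ^+ (2 * k))).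
Proof.
move=> z1 k A u C.
have p1 : (1 < size p)%N by rewrite hp ltnS ltnW.
have [k0 ak0 aj0] := rn_kP _ p z0 p1; rewrite -/k in k0 ak0 aj0.
have aA := normc_nderivn_le _ p z0; rewrite -/A in aA.
have uE := rn_uE _ p z0; rewrite -/k -/u in uE.
have u0 : u != 0 by rewrite uE mulf_neq0 // conjc_eq0.
have a0A : normc p.[z0] <= A by have := aA 0%N; rewrite nderivn0.
have A0 : 0 < A := lt_le_trans (normc_gt0 _ _ hz0) a0A.
have U0 := normc_gt0 _ _ u0.
have UA : normc u <= A ^+ 2.
  by rewrite uE normcM normc_conj expr2 ler_pM ?normc_ge0.
have /andP[cge cle] := rn_c_bounds _ p z0; rewrite -/k -/u in cge cle.
have angle := Re_rn_angle _ _ _ _ k0 htheta; rewrite -/k -/u in angle.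
set c := rn_c p z0 in cge cle angle.
set U := normc u in U0 UA cge cle *.
pose q := U ^ (2 - k%:Z).
have q0 : 0 < q by rewrite exprz_gt0.
have qU : q * U ^+ k = U ^+ 2.
  by rewrite /q -[U ^+ k]/(U ^ k%:Z) -expfzDr ?gt_eqF // subrK.
have qU1 : q * U ^+ k.-1 = U.
  apply: (mulIf (lt0r_neq0 U0)).
  by rewrite -mulrA -exprSr prednK // qU expr2.
pose r := C / 3.
(* The 18 combines the 6 in the denominator of C with the division by 3. *)
have rE : 18 * A ^+ 2 * r = c * q.
  by rewrite /r /C /rn_C -/k -/u -/A -/U -/q -/c; field; rewrite gt_eqF.
have cq : U <= c * q <= 2 * U.
  rewrite -{1}qU1 [q * _]mulrC ler_wpM2r ?(ltW q0) //=.
  have -> : 2 * U = 2 * U ^+ k.-1 * q by rewrite -mulrA [_ * q]mulrC qU1.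
  by rewrite ler_wpM2r // ltW.
have /andP[r0 r9] := step_size_bounds _ _ _ _ _ U0 UA cq rE.
rewrite -/r; split; last first.
  by apply: descent_value_le => //; rewrite rE; case/andP: cq.
apply: sqmod_descent => //.
  by rewrite normc_robust_step // ltW.
(* Conjugating u = a_0 conj(a_k) gives conj(a_0) a_k, the coefficient in the cross term. *)
have -> w : p.[z0]^* * (p^`N(k).[z0] * w ^+ k) = u^* * w ^+ k.
  by rewrite uE (rmorphM (@conjc R)) /= conjcK mulrA.
rewrite (robust_step_factor _ _ q) // ReZ mulrCA angle -/r [r ^+ k.+1]exprS.
(* The real part is now - c q r^k, and [rE] trades c q for 18 A^2 r, supplying the extra power of
   r. *)
by rewrite mulrN [q * _ * c]mulrC [c * (q * _)]mulrA -rE -mulrA !mulNr.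
Qed.
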